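(* Suppose $\lambda^*/n\to0$ as $n\to\infty$. If $\lambda_j\to\infty$ and $\sqrt{n}\,\lambda_j/\lambda^*\to\infty$ as $n\to\infty$ for all $j=1,\dots,p$, then for every $\beta\in\mathbb{R}^p$, $$P_\beta\big(\hat\beta_{AL,j}\neq0\iff j\in\mathcal{A}\ \text{ for all } j\big)\to1\quad\text{as } n\to\infty.$$
   Context: For each $n\ge p$: linear regression model $y=X\beta+\varepsilon$ with $y\in\mathbb{R}^n$, non-stochastic $X\in\mathbb{R}^{n\times p}$ ($p$ fixed) of full column rank, unknown $\beta\in\mathbb{R}^p$, and $\varepsilon$ with i.i.d. components of mean zero and finite variance $\sigma^2>0$; $P_\beta$ is the probability when the true parameter is $\beta$. $X'X/n\to C$ positive definite as $n\to\infty$. $\hat\beta_{LS}=(X'X)^{-1}X'y$; the events $\{\hat\beta_{LS,j}=0\}$ have probability zero and are excluded. Non-negative tuning parameters $\lambda_j=\lambda_{n,j}$, $\lambda^*=\max_j\lambda_j$. Adaptive Lasso: $\hat\beta_{AL}=\arg\min_{b\in\mathbb{R}^p}\big(\|y-Xb\|^2+2\sum_{j=1}^p\lambda_j|b_j|/|\hat\beta_{LS,j}|\big)$. The active set is $\mathcal{A}=\{j:\beta_j\neq0\}$. *)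

(* Defs.v *)
From HB Require Import structures.
From mathcomp Require Import all_boot all_order all_algebra.
From mathcomp Require Import all_classical all_reals all_analysis.
Set Implicit Arguments. Unset Strict Implicit. Unset Printing Implicit Defensive.
Import Order.TTheory GRing.Theory Num.Theory.
Import numFieldNormedType.Exports.
Local Open Scope classical_set_scope.
Local Open Scope ring_scope.

Definition mutually_independent d (T : measurableType d) (R : realType)
  (P : probability T R) (n : nat) (e : 'I_n -> {RV P >-> R}) : Prop :=
  forall B : 'I_n -> set R, (forall i, measurable (B i)) ->
    P (\bigcap_(i in [set: 'I_n]) (e i @^-1` B i)) =
    (\prod_(i < n) P (e i @^-1` B i))%E.

Definition resp d (T : measurableType d) (R : realType) (P : probability T R)
  (n p : nat) (X : 'M[R]_(n, p)) (beta : 'cV[R]_p)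
  (e : 'I_n -> {RV P >-> R}) (w : T) : 'cV[R]_n :=
  X *m beta + \col_i e i w.

Definition lsq (R : realType) (n p : nat) (X : 'M[R]_(n, p)) (y : 'cV[R]_n)
  : 'cV[R]_p := invmx (X^T *m X) *m X^T *m y.

Definition al_obj (R : realType) (n p : nat) (X : 'M[R]_(n, p))
  (lam : 'I_p -> R) (y : 'cV[R]_n) (b : 'cV[R]_p) : R :=
  \sum_(i < n) ((y - X *m b) i 0) ^+ 2
  + 2 * \sum_(j < p) lam j * `|b j 0| / `|lsq X y j 0|.

Definition is_al (R : realType) (n p : nat) (X : 'M[R]_(n, p))
  (lam : 'I_p -> R) (y : 'cV[R]_n) (b : 'cV[R]_p) : Prop :=
  forall b' : 'cV[R]_p, al_obj X lam y b <= al_obj X lam y b'.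

Definition lam_star (R : realType) (p : nat) (lam : 'I_p -> R) : R :=
  \big[Num.max/0]_(j < p) lam j.

Definition sel_consistent_event d (T : measurableType d) (R : realType)
  (P : probability T R) (n p : nat) (X : 'M[R]_(n, p)) (lam : 'I_p -> R)
  (beta : 'cV[R]_p) (e : 'I_n -> {RV P >-> R}) : set T :=
  [set w | (forall j, lsq X (resp X beta e w) j 0 != 0) /\
           forall b, is_al X lam (resp X beta e w) b ->
             forall j : 'I_p, (b j 0 != 0) <-> (beta j 0 != 0)].

(* Main.v *)
(** Let [Q = X'X] and let [g = X'eps] be the score at the true parameter; by
Chebyshev [|g_k| <= M sqrt n] for all [k] outside an event of probability
[O(1/M^2)], and there the least squares error is [O(1 / sqrt n)].  On that
event every minimizer [b] has the correct support once [n] is large.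

- Comparing the objective at [b] and at [beta], and using [Q >= c n], gives
  [|b - beta| = O((sqrt n + lambda_star) / n) -> 0]: no active coordinate is
  lost.
- If [b_j <> 0] for an inactive [j], stationarity makes the score at [b] equal
  to [lambda_j / |beta_LS_j|], which is at least of order [lambda_j sqrt n],
  whereas the score at [b] is [g - Q (b - beta) = O(sqrt n + lambda_star)].
  This contradicts [lambda_j -> oo] and [sqrt n lambda_j / lambda_star -> oo].

Probabilities are only meaningful on measurable events, so measurability of
the selection event has to be proved too: by the stationarity conditions a
minimizer is determined, through a linear system, by its vector of signs, so
the event is a finite Boolean combination of measurable conditions.  Neither
existence nor uniqueness of minimizers is needed. *)
Require Import Defs.
From HB Require Import structures.
From mathcomp Require Import all_boot all_order all_algebra.
From mathcomp Require Import all_classical all_reals all_analysis.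
From mathcomp Require Import measurable_realfun ring lra.
Import Order.TTheory GRing.Theory Num.Theory.
Import numFieldNormedType.Exports.
Local Open Scope classical_set_scope.
Local Open Scope ring_scope.

(** * Linear combinations of independent errors *)

Section LinearCombination.
Context d (T : measurableType d) (R : realType) (P : probability T R).
Local Open Scope ereal_scope.

(** The joint law of [X] and [Y] agrees with the product of the marginal laws on rectangles, hence
    everywhere, and Fubini splits the integral of the product. *)
Lemma expectationM_indep (X Y : {RV P >-> R}) :
    (forall A B : set R, measurable A -> measurable B ->
      P (X @^-1` A `&` Y @^-1` B) = P (X @^-1` A) * P (Y @^-1` B)) ->
    (X : T -> R) \in Lfun P 2%:E -> (Y : T -> R) \in Lfun P 2%:E ->
  'E_P[X \* Y] = 'E_P[X] * 'E_P[Y].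
Proof.
move=> indep X2 Y2.
have Pfin : P setT \is a fin_num := fin_num_measure P _ measurableT.
have /Lfun1_integrable iX := Lfun_subset12 Pfin X2.
have /Lfun1_integrable iY := Lfun_subset12 Pfin Y2.
have /Lfun1_integrable iXY := Lfun2_mul_Lfun1 X2 Y2.
have mX : measurable_fun setT X by [].
have mY : measurable_fun setT Y by [].
pose mZ := isMeasurableFun.Build _ _ _ _ _ (measurable_fun_pair mX mY).
pose Z : {RV P >-> (R * R)%type} := MeasurableFun.Pack (MeasurableFun.Class mZ).
pose f (z : R * R) := (z.1 * z.2)%:E.
have mf : measurable_fun setT f by apply/measurable_EFinP; exact: measurable_funM.
have prodE (A : set (R * R)) : measurable A ->
    (distribution P X \x distribution P Y) A = distribution P Z A.
  apply: (@product_measure_unique _ _ _ _ R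
    (distribution P X) (distribution P Y) (distribution P Z)).
  move=> B C mB mC. exact: (indep B C mB mC).
have iZ : (distribution P Z).-integrable setT f by exact: integrable_pushforward.
have iXxY : (distribution P X \x distribution P Y).-integrable setT f.
  apply/integrableP; split => //; move/integrableP: iZ => [_].
  apply: le_lt_trans; rewrite (eq_measure_integral (distribution P Z)) // => A mA _.
  exact: prodE.
rewrite [in LHS]unlock -[LHS](@integral_distribution _ _ _ _ _ P Z f)//.
rewrite -(eq_measure_integral (distribution P Z)
  (m1 := (distribution P X \x distribution P Y))); last by move=> A mA _; exact: prodE.
rewrite -(integral12_prod_meas1 iXxY).
have EY : \int[distribution P Y]_y y%:E = 'E_P[Y].
  by rewrite unlock -[RHS](@integral_distribution _ _ _ _ _ P Y EFin).
have iY' : (distribution P Y).-integrable setT EFin by exact: integrable_pushforward.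
have iX' : (distribution P X).-integrable setT EFin by exact: integrable_pushforward.
have fEY : 'E_P[Y] \is a fin_num by exact/expectation_fin_num/Lfun1_integrable.
have inner x : \int[distribution P Y]_y f (x, y) = x%:E * 'E_P[Y].
  under eq_integral do rewrite /f /= EFinM.
  by rewrite integralZl// EY.
rewrite (eq_integral (fun x : R => x%:E * (fine 'E_P[Y])%:E)); last first.
  by move=> x _; rewrite fineK//; exact: inner.
rewrite integralZr// fineK//.
by congr (_ * _); rewrite unlock -[RHS](@integral_distribution _ _ _ _ _ P X EFin).
Qed.

Lemma mutually_independent_pair (n : nat) (e : 'I_n -> {RV P >-> R}) (i j : 'I_n)
    (A B : set R) : mutually_independent e -> i != j -> measurable A -> measurable B ->
  P (e i @^-1` A `&` e j @^-1` B) = P (e i @^-1` A) * P (e j @^-1` B).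
Proof.
move=> inde ij mA mB.
(* All other events are set to [setT], so their factors are 1. *)
pose F k := if k == i then A else if k == j then B else setT.
have mF k : measurable (F k) by rewrite /F; case: ifP => // _; case: ifP.
have /= := inde F mF.
rewrite (bigD1 i)//= (bigD1 j)/=; last by rewrite eq_sym.
rewrite [X in _ * (_ * X)]big1 => [|k /andP[ki kj]]; last first.
  by rewrite /F (negbTE ki) (negbTE kj) preimage_setT probability_setT.
rewrite mule1 {2 3}/F eqxx eq_sym (negbTE ij) eqxx => <-; congr (P _).
apply/seteqP; split=> [w [Aw Bw] k _|w Fw].
  by rewrite /F /preimage /=; case: eqVneq => [->//|_]; case: eqVneq => [->//|].
split; [have := Fw i I|have := Fw j I]; rewrite /F /preimage /= eqxx //.
by rewrite eq_sym (negbTE ij).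
Qed.

Lemma Lfun2_sum (I : Type) (r : seq I) (f : I -> T -> R) :
    (forall i, f i \in Lfun P 2%:E) ->
  (fun w => \sum_(i <- r) f i w)%R \in Lfun P 2%:E.
Proof.
move=> f2; rewrite (_ : (fun w => _) = (\sum_(i <- r) f i)%R); last first.
  by apply/funext => w; rewrite fct_sumE.
by rewrite rpred_sum ?lee1n//.
Qed.

Lemma covariance_suml (I : Type) (r : seq I) (f : I -> T -> R) (g : T -> R) :
    (forall i, f i \in Lfun P 2%:E) -> g \in Lfun P 2%:E ->
  covariance P (fun w => \sum_(i <- r) f i w)%R g = \sum_(i <- r) covariance P (f i) g.
Proof.
move=> f2 g2; elim: r => [|i r IH].
  rewrite big_nil -[RHS](covariance_cst_l P 0 g); congr (covariance P _ g).
  by apply/funext => w; rewrite big_nil.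
rewrite big_cons -IH -covarianceDl ?Lfun2_sum//.
by congr (covariance P _ g); apply/funext => w; rewrite big_cons.
Qed.

(** Covariance is bilinear, and independence kills the off-diagonal terms. *)
Lemma variance_linear_combination (n : nat) (e : 'I_n -> {RV P >-> R}) (a : 'I_n -> R) (s : R) :
    mutually_independent e -> (forall i, (e i : T -> R) \in Lfun P 2%:E) ->
    (forall i, 'E_P[e i] = 0) -> (forall i, variance P (e i) = s%:E) ->
  variance P (fun w => \sum_i a i * e i w)%R = (s * \sum_i a i ^+ 2)%:E.
Proof.
move=> inde e2 e0 ves.
have Pfin : P setT \is a fin_num := fin_num_measure P _ measurableT.
have cove i j : covariance P (e i) (e j) = (if i == j then s else 0)%:E.
  case: eqVneq => [<-|ij]; first exact: ves.
  rewrite covarianceE ?Lfun2_mul_Lfun1 ?Lfun_subset12//.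
  rewrite expectationM_indep ?e0 ?mule0 ?sube0// => A B mA mB.
  exact: mutually_independent_pair.
have aeE i : (fun w => a i * e i w)%R = (a i \o* e i)%R.
  by apply/funext => w /=; rewrite mulrC.
have ae2 i : (fun w => a i * e i w)%R \in Lfun P 2%:E.
  by rewrite aeE Lfun_scale ?ler1n.
have covae i j : covariance P (fun w => a i * e i w)%R (fun w => a j * e j w)%R =
    (a i * a j * if i == j then s else 0)%:E.
  rewrite !aeE.
  rewrite covarianceZl ?covarianceZr ?Lfun2_mul_Lfun1 ?Lfun_scale ?ler1n ?Lfun_subset12//;
    last exact: Lfun_cst.
  by rewrite cove -!EFinM mulrA.
rewrite /variance; have /= -> :=
  covariance_suml _ (index_enum 'I_n) _ _ ae2 (Lfun2_sum _ (index_enum 'I_n) _ ae2).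
rewrite (eq_bigr (fun i => (s * a i ^+ 2)%:E)) => [|i _]; last first.
  rewrite covarianceC; have /= -> := covariance_suml _ (index_enum 'I_n) _ _ ae2 (ae2 i).
  rewrite (bigD1 i)//= big1 => [|j ji].
    by rewrite covae eqxx adde0 mulrC expr2.
  by rewrite covae (negbTE ji) mulr0.
by rewrite sumEFin mulr_sumr.
Qed.

Lemma chebyshev_linear_combination (n : nat) (e : 'I_n -> {RV P >-> R}) (a : 'I_n -> R)
    (s t : R) :
    mutually_independent e -> (forall i, (e i : T -> R) \in Lfun P 2%:E) ->
    (forall i, 'E_P[e i] = 0) -> (forall i, variance P (e i) = s%:E) -> (0 < t)%R ->
  P [set w | t <= `|\sum_i a i * e i w|]%R <= (s * (\sum_i a i ^+ 2) / t ^+ 2)%:E.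
Proof.
move=> inde e2 e0 ves t0.
have Pfin : P setT \is a fin_num := fin_num_measure P _ measurableT.
pose g w := (\sum_i a i * e i w)%R.
have mg : measurable_fun setT g by apply: measurable_sum => i; exact: measurable_funM.
pose mfg := isMeasurableFun.Build _ _ _ _ _ mg.
pose G : {RV P >-> R} := MeasurableFun.Pack (MeasurableFun.Class mfg).
have Eg : 'E_P[g] = 0.
  rewrite /g (_ : (fun w => _) = (\sum_(f <- [seq (a i \o* e i)%R | i <- index_enum 'I_n]) f)%R);
    last first.
    by apply/funext => w; rewrite big_map fct_sumE; apply: eq_bigr => i _ /=; rewrite mulrC.
  rewrite expectation_sum => [|f /mapP[i _ ->]]; last first.
    by rewrite Lfun_scale ?Lfun_subset12.
  by rewrite big_map big1// => i _; rewrite expectationZl ?Lfun_subset12// e0 mule0.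
have := chebyshev G t0; rewrite /= -/g Eg /=.
under eq_set do rewrite subr0.
move=> /le_trans; apply.
rewrite (variance_linear_combination _ _ _ _ inde e2 e0 ves) -EFinM lee_fin.
by rewrite mulrC.
Qed.
End LinearCombination.

(** * Stationarity conditions *)

Section Objective.
Context {R : realType} {n p : nat}.
Implicit Types (X : 'M[R]_(n, p)) (y : 'cV[R]_n) (b v : 'cV[R]_p) (lam : 'I_p -> R).

(** A zero least squares coordinate gives weight 0, since [x / 0 = 0]; this agrees with [al_obj], so
    the expansions below hold for every [y]. *)
Definition al_weight X lam y (j : 'I_p) : R := lam j / `|lsq X y j 0|.

(** Minus half the gradient at [b] of the residual sum of squares. *)
Definition score X y b : 'cV[R]_p := X^T *m (y - X *m b).

Lemma sum_sqr_mulmx X v :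
  \sum_i (X *m v) i 0 ^+ 2 = \sum_j v j 0 * ((X^T *m X) *m v) j 0.
Proof.
have -> : \sum_j v j 0 * ((X^T *m X) *m v) j 0 = (v^T *m ((X^T *m X) *m v)) 0 0.
  by rewrite [RHS]mxE; apply: eq_bigr => j _; congr (_ * _); rewrite mxE.
have -> : v^T *m ((X^T *m X) *m v) = (X *m v)^T *m (X *m v).
  by rewrite trmx_mul !mulmxA.
by rewrite [RHS]mxE; apply: eq_bigr => i _; rewrite [in RHS]mxE expr2.
Qed.

Lemma sum_mul_mulmx X (r : 'cV[R]_n) v :
  \sum_i r i 0 * (X *m v) i 0 = \sum_j (X^T *m r) j 0 * v j 0.
Proof.
have -> : \sum_i r i 0 * (X *m v) i 0 = (r^T *m (X *m v)) 0 0.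
  by rewrite [RHS]mxE; apply: eq_bigr => j _; congr (_ * _); rewrite mxE.
rewrite mulmxA -[r^T *m X]trmxK trmx_mul trmxK [LHS]mxE.
by apply: eq_bigr => j _; rewrite [in LHS]mxE.
Qed.

Lemma al_objD X lam y b v :
  al_obj X lam y (b + v) = al_obj X lam y b + \sum_i (X *m v) i 0 ^+ 2
    - 2 * \sum_j score X y b j 0 * v j 0
    + 2 * \sum_j al_weight X lam y j * (`|b j 0 + v j 0| - `|b j 0|).
Proof.
rewrite /al_obj /score -sum_mul_mulmx.
have -> : \sum_(i < n) ((y - X *m (b + v)) i 0) ^+ 2 =
    \sum_(i < n) ((y - X *m b) i 0) ^+ 2 + \sum_i (X *m v) i 0 ^+ 2
    - 2 * \sum_i (y - X *m b) i 0 * (X *m v) i 0.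
  rewrite mulr_sumr -big_split -sumrB; apply: eq_bigr => i _ /=.
  by rewrite mulmxDr !mxE; ring.
have -> : \sum_(j < p) lam j * `|(b + v) j 0| / `|lsq X y j 0| =
    \sum_(j < p) lam j * `|b j 0| / `|lsq X y j 0|
    + \sum_j al_weight X lam y j * (`|b j 0 + v j 0| - `|b j 0|).
  rewrite -big_split; apply: eq_bigr => j _ /=.
  by rewrite /al_weight !mxE; ring.
ring.
Qed.

Lemma al_obj_coord X lam y b (j : 'I_p) (t : R) :
  al_obj X lam y (b + t *: delta_mx j 0) = al_obj X lam y b + t ^+ 2 * (X^T *m X) j j
    - 2 * t * score X y b j 0 + 2 * al_weight X lam y j * (`|b j 0 + t| - `|b j 0|).
Proof.
set v : 'cV[R]_p := t *: delta_mx j 0.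
have vE k : v k 0 = if k == j then t else 0.
  by rewrite !mxE eqxx andbT; case: eqP => _; rewrite ?mulr1 ?mulr0.
rewrite al_objD sum_sqr_mulmx.
have -> : \sum_k v k 0 * (X^T *m X *m v) k 0 = t ^+ 2 * (X^T *m X) j j.
  rewrite (bigD1 j)//= big1 => [|k kj]; last by rewrite vE (negbTE kj) mul0r.
  by rewrite vE eqxx /v -scalemxAr -colE [X in _ * X]mxE [X in _ * (_ * X)]mxE; ring.
have -> : \sum_k score X y b k 0 * v k 0 = score X y b j 0 * t.
  rewrite (bigD1 j)//= big1 => [|k kj]; last by rewrite vE (negbTE kj) mulr0.
  by rewrite vE eqxx addr0.
have -> : \sum_k al_weight X lam y k * (`|b k 0 + v k 0| - `|b k 0|)
    = al_weight X lam y j * (`|b j 0 + t| - `|b j 0|).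
  rewrite (bigD1 j)//= big1 => [|k kj]; last by rewrite vE (negbTE kj) addr0 subrr mulr0.
  by rewrite vE eqxx addr0.
ring.
Qed.

(** Lets [s] tend to 0 without limits: if [y < x], the [s] chosen in the proof makes [s * z] at most
    half the gap [x - y]. *)
Lemma ler_of_scaled_slack (x y z : R) :
  (forall s, 0 < s -> s <= 1 -> x <= y + s * z) -> x <= y.
Proof.
move=> H; rewrite leNgt; apply/negP => yx.
pose s := Num.min 1 ((x - y) / (2 * (`|z| + 1))).
have z0 : 0 < 2 * (`|z| + 1) by have := normr_ge0 z; lra.
have s0 : 0 < s by rewrite lt_min ltr01 divr_gt0// subr_gt0.
have s1 : s <= 1 by rewrite ge_min lexx.
have s2 : s * (2 * (`|z| + 1)) <= x - y by rewrite -ler_pdivlMr// ge_min lexx orbT.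
have := H s s0 s1.
have : s * z <= s * `|z| by rewrite ler_wpM2l ?ler_norm// ltW.
nra.
Qed.

(** The conclusion says that [h] is [mu] times a subgradient of the absolute value at [b]. It comes
    from small moves [t], whose curvature term is of second order. *)
Lemma lasso_scalar_optimality (q h mu b : R) :
    (forall t, 0 <= t ^+ 2 * q - 2 * t * h + 2 * mu * (`|b + t| - `|b|)) -> 0 <= mu ->
  `|h| <= mu /\ h * b = mu * `|b|.
Proof.
move=> opt mu0.
have hmu : `|h| <= mu.
  have [->|h0] := eqVneq h 0; first by rewrite normr0.
  apply: (@ler_of_scaled_slack _ _ (q / 2)) => s s0 s1.
  (* A move along the sign of [h] gains [2 * s * |h|] and costs at most [2 * s * mu] in penalty. *)
  have := opt (s * Num.sg h).
  have -> : (s * Num.sg h) ^+ 2 * q = s ^+ 2 * q by rewrite exprMn sqr_sg h0 mulr1.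
  have -> : 2 * (s * Num.sg h) * h = 2 * s * `|h| by rewrite normrEsg; ring.
  have tri : `|b + s * Num.sg h| - `|b| <= s.
    rewrite lerBlDl (le_trans (ler_normD _ _))// lerD2l normrM normr_sg h0.
    by rewrite mulr1 gtr0_norm.
  have := ler_wpM2l mu0 tri => mutri H.
  have : 0 <= s * (s * q - 2 * `|h| + 2 * mu) by nra.
  rewrite pmulr_rge0//; lra.
split=> //; apply/eqP; rewrite eq_le; apply/andP; split.
  by rewrite (le_trans (ler_norm _))// normrM ler_wpM2r.
apply: (@ler_of_scaled_slack _ _ (b ^+ 2 * q / 2)) => s s0 s1.
(* Shrinking [b] by the factor [1 - s] lowers its absolute value by exactly [s * |b|]. *)
have := opt (- (s * b)).
have -> : b - s * b = (1 - s) * b by ring.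
rewrite normrM ger0_norm ?subr_ge0//.
have -> : (- (s * b)) ^+ 2 * q - 2 * - (s * b) * h + 2 * mu * ((1 - s) * `|b| - `|b|)
  = 2 * s * (s * (b ^+ 2 * q / 2) + h * b - mu * `|b|) by field.
rewrite pmulr_rge0; last by rewrite mulr_gt0.
lra.
Qed.

(** Coordinate moves give necessity. Conversely, the penalty increment dominates the linear term of
    [al_objD], and the quadratic term is nonnegative. *)
Lemma is_alP X lam y b : (forall j, 0 <= lam j) ->
  is_al X lam y b <-> forall j, `|score X y b j 0| <= al_weight X lam y j /\
    score X y b j 0 * b j 0 = al_weight X lam y j * `|b j 0|.
Proof.
move=> lam0.
have w0 j : 0 <= al_weight X lam y j by rewrite divr_ge0.
split=> [opt j|kkt b'].
  apply: (@lasso_scalar_optimality ((X^T *m X) j j)) => // t.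
  have := opt (b + t *: delta_mx j 0); rewrite al_obj_coord; lra.
rewrite -[b'](subrK b) addrC al_objD.
set v := b' - b.
have : 0 <= \sum_i (X *m v) i 0 ^+ 2 by apply: sumr_ge0 => i _; exact: sqr_ge0.
have : \sum_j score X y b j 0 * v j 0 <=
    \sum_j al_weight X lam y j * (`|b j 0 + v j 0| - `|b j 0|).
  apply: ler_sum => j _; have [hj sj] := kkt j.
  rewrite mulrBr -sj.
  have : score X y b j 0 * (b j 0 + v j 0) <= al_weight X lam y j * `|b j 0 + v j 0|.
    by rewrite (le_trans (ler_norm _))// normrM ler_wpM2r.
  lra.
lra.
Qed.

End Objective.

(** * Measurability of the selection event *)

Section Candidates.
Context {R : realType} {n p : nat}.
Implicit Types (X : 'M[R]_(n, p)) (y : 'cV[R]_n) (b v : 'cV[R]_p) (lam : 'I_p -> R).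

Lemma unitmx_ker0 (A : 'M[R]_p) : (forall v, A *m v = 0 -> v = 0) -> A \in unitmx.
Proof.
move=> kerA; rewrite -unitmx_tr -row_free_unit -kermx_eq0.
apply/rowV0P => u /sub_kermxP uA0.
by rewrite -[u]trmxK (kerA u^T) ?trmx0// -[A]trmxK -trmx_mul uA0 trmx0.
Qed.

Lemma full_column_rank_inj X v : \rank X = p -> X *m v = 0 -> v = 0.
Proof.
move=> rX Xv0; apply: trmx_inj; rewrite trmx0; apply/eqP.
have free : row_free X^T by rewrite -row_leq_rank mxrank_tr rX.
by rewrite -(mulmx_free_eq0 _ free) -trmx_mul Xv0 trmx0.
Qed.

Lemma mulmx_eq0_sqr X v : \sum_i (X *m v) i 0 ^+ 2 = 0 -> X *m v = 0.
Proof.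
move=> /eqP; rewrite psumr_eq0 => [/allP H|i _]; last exact: sqr_ge0.
apply/colP => i; apply/eqP; rewrite [X in _ == X]mxE.
by have := H i (mem_index_enum _); rewrite /= sqrf_eq0.
Qed.

(** Rows outside [S] are identity rows, which force a zero coordinate, so one [p] by [p] shape
    serves every active set. *)
Definition active_gram X (S : {set 'I_p}) : 'M[R]_p :=
  \matrix_(i, j) if i \in S then (X^T *m X) i j else (i == j)%:R.

(** For [v] in the kernel, each [j] has [v j 0 = 0] or a zero entry in [X^T *m X *m v]; hence
    [X *m v] has zero norm. *)
Lemma active_gram_unit X (S : {set 'I_p}) : \rank X = p -> active_gram X S \in unitmx.
Proof.
move=> rX; apply: unitmx_ker0 => v Gv0.
have row j : (active_gram X S *m v) j 0 = if j \in S then (X^T *m X *m v) j 0 else v j 0.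
  rewrite mxE; case: ifPn => jS.
    by rewrite [in RHS]mxE; apply: eq_bigr => k _; rewrite mxE jS.
  rewrite (bigD1 j)//= big1 => [|k kj]; rewrite mxE (negbTE jS) ?eqxx ?mul1r ?addr0//.
  by rewrite eq_sym (negbTE kj) mul0r.
apply: (full_column_rank_inj X) => //; apply: mulmx_eq0_sqr.
rewrite sum_sqr_mulmx big1// => j _.
have := row j; rewrite Gv0 mxE; case: ifP => _ <-; rewrite ?mulr0 ?mul0r//.
Qed.

(* With [SN] = (active set, negative coordinates), the stationarity
   equations of the criterion are linear; this is their only solution. *)
Definition al_candidate X lam y (SN : {set 'I_p} * {set 'I_p}) : 'cV[R]_p :=
  invmx (active_gram X SN.1) *m \col_j
    if j \in SN.1 then (X^T *m y) j 0 - (-1) ^+ (j \in SN.2) * al_weight X lam y j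
    else 0.

(** On an active coordinate, complementarity can be divided by [b j 0], leaving a linear equation. A
    candidate need not be optimal, so optimality is tested separately below. *)
Lemma is_al_candidate X lam y b : \rank X = p -> (forall j, 0 <= lam j) ->
  is_al X lam y b -> exists SN, b = al_candidate X lam y SN.
Proof.
move=> rX lam0 /(is_alP _ _ _ _ lam0) kkt.
exists ([set j | b j 0 != 0]%SET, [set j | b j 0 < 0]%SET).
apply: (canRL (mulKmx (active_gram_unit _ _ rX))).
apply/colP => j; rewrite [RHS]mxE /= inE.
have [_ sj] := kkt j; case: ifPn => bj.
  have -> : (active_gram X [set j | b j 0 != 0]%SET *m b) j 0 = (X^T *m X *m b) j 0.
    rewrite [LHS]mxE [RHS]mxE; apply: eq_bigr => k _; congr (_ * _).
    by rewrite mxE inE bj.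
  have scoreE : score X y b j 0 = (X^T *m y) j 0 - (X^T *m X *m b) j 0.
    by rewrite /score mulmxBr mulmxA mxE [X in _ + X]mxE.
  have : score X y b j 0 = (-1) ^+ (b j 0 < 0)%R * al_weight X lam y j.
    apply: (mulIf bj); rewrite sj; case: ltrP => b0.
      by rewrite ltr0_norm// expr1; ring.
    by rewrite ger0_norm// expr0; ring.
  rewrite inE scoreE => <-; ring.
rewrite mxE big1// => k _; rewrite mxE inE (negbTE bj).
move: bj; rewrite negbK => /eqP bj.
by case: eqVneq => [<-|_]; rewrite ?bj ?mulr0 ?mul0r.
Qed.

End Candidates.

Section Measurability.
Context d (T : measurableType d) (R : realType) (P : probability T R).

Lemma measurable_bool_set (b : T -> bool) : measurable_fun setT b -> measurable [set w | b w].
Proof. by move=> mb; rewrite -[X in measurable X]setTI; exact: (mb measurableT [set true]). Qed.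

(** The inverse is taken as the power [-1]; both vanish at 0. *)
Lemma measurable_invr_norm (f : T -> R) : measurable_fun setT f ->
  measurable_fun setT (fun w => `|f w|^-1).
Proof.
move=> mf; under eq_fun do rewrite -powR_inv1//.
apply: (@measurableT_comp _ _ _ _ _ _ (@powR R ^~ (-1)))%R => //.
by apply: measurableT_comp.
Qed.

Lemma measurable_mulmx (m q : nat) (A : 'M[R]_(m, q)) (v : T -> 'cV[R]_q) :
    (forall j, measurable_fun setT (fun w => v w j 0)) ->
  forall i, measurable_fun setT (fun w => (A *m v w) i 0).
Proof.
move=> mv i; under eq_fun do rewrite mxE.
by apply: measurable_sum => j; exact: measurable_funM.
Qed.

Context (n p : nat) (X : 'M[R]_(n, p)) (lam : 'I_p -> R) (beta : 'cV[R]_p).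
Context (e : 'I_n -> {RV P >-> R}).
Hypothesis rX : \rank X = p.
Hypothesis lam0 : forall j, 0 <= lam j.
Let y := resp X beta e.

Let my i : measurable_fun setT (fun w => y w i 0).
Proof.
under eq_fun do rewrite mxE [X in _ + X]mxE.
by apply: measurable_funD => //; exact: measurable_funP.
Qed.

Lemma measurable_lsq j : measurable_fun setT (fun w => lsq X (y w) j 0).
Proof. exact: measurable_mulmx. Qed.

Let mweight j : measurable_fun setT (fun w => al_weight X lam (y w) j).
Proof. by apply: measurable_funM => //; exact/measurable_invr_norm/measurable_lsq. Qed.

Let mcandidate SN j : measurable_fun setT (fun w => al_candidate X lam (y w) SN j 0).
Proof.
apply: measurable_mulmx => k; have [kS|kS] := boolP (k \in SN.1).
  under eq_fun do rewrite mxE kS; apply: measurable_funB; first exact: measurable_mulmx.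
  exact: measurable_funM.
under eq_fun do rewrite mxE (negbTE kS). exact: measurable_cst.
Qed.

Let mscore SN j :
  measurable_fun setT (fun w => score X (y w) (al_candidate X lam (y w) SN) j 0).
Proof.
apply: measurable_mulmx => k; under eq_fun do rewrite [_ k 0]mxE [X in _ + X]mxE.
apply: measurable_funB => //; exact: measurable_mulmx.
Qed.

(** Stationarity replaces the comparison with all vectors by finitely many measurable conditions. *)
Lemma measurable_al_candidate_opt SN :
  measurable [set w | is_al X lam (y w) (al_candidate X lam (y w) SN)].
Proof.
pose b w := al_candidate X lam (y w) SN.
rewrite (_ : [set w | _] = \bigcap_(j in [set: 'I_p])
   [set w | (`|score X (y w) (b w) j 0| <= al_weight X lam (y w) j)
    && (score X (y w) (b w) j 0 * b w j 0 ==
        al_weight X lam (y w) j * `|b w j 0|)]); last first.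
  apply/seteqP; split=> w /=.
    move=> /(is_alP _ _ _ _ lam0) H j _ /=.
    by have [-> ->] := H j; rewrite eqxx.
  move=> H; apply/(is_alP _ _ _ _ lam0) => j.
  by have /andP[? /eqP ?] := H j I.
apply: fin_bigcap_measurable => // j _; apply: measurable_bool_set.
apply: measurable_and.
  apply: measurable_fun_ler => //.
  by apply: (@measurableT_comp _ _ _ _ _ _ (@Num.norm R R)) => //; exact: mscore.
apply: measurable_fun_eqr.
  by apply: measurable_funM; [exact: mscore|exact: mcandidate].
apply: measurable_funM => //.
by apply: (@measurableT_comp _ _ _ _ _ _ (@Num.norm R R)) => //; exact: mcandidate.
Qed.

(** The quantifier over all minimizers reduces to the finitely many candidates that pass the
    optimality test. *)
Lemma measurable_sel_consistent_event : measurable (sel_consistent_event X lam beta e).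
Proof.
rewrite (_ : sel_consistent_event _ _ _ _ =
  \bigcap_(j in [set: 'I_p]) [set w | lsq X (y w) j 0 != 0] `&`
  \bigcap_(SN in [set: {set 'I_p} * {set 'I_p}])
    (~` [set w | is_al X lam (y w) (al_candidate X lam (y w) SN)] `|`
    \bigcap_(j in [set: 'I_p])
      [set w | (al_candidate X lam (y w) SN j 0 != 0) == (beta j 0 != 0)])); last first.
  apply/seteqP; split=> w /=.
    move=> [ls0 sel]; split=> [j _|SN _]; first exact: ls0.
    have [opt|] := pselect (is_al X lam (y w) (al_candidate X lam (y w) SN)); last by left.
    right => j _ /=; have [sj js] := sel _ opt j; apply/eqP.
    by apply/idP/idP; [exact: sj|exact: js].
  move=> [ls0 sel]; split=> [j|b opt j]; first exact: ls0.
  have [SN bE] := is_al_candidate _ _ _ _ rX lam0 opt.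
  have [|/(_ j I) /= /eqP] := sel SN I; first by rewrite /= -bE.
  by rewrite -bE => ->.
apply: measurableI.
  apply: fin_bigcap_measurable => // j _; apply: measurable_bool_set.
  apply: measurable_neg; apply: measurable_fun_eqr => //; exact: measurable_lsq.
apply: fin_bigcap_measurable => [|SN _]; first exact: finite_finset.
apply: measurableU; first exact/measurableC/measurable_al_candidate_opt.
apply: fin_bigcap_measurable => // j _; apply: measurable_bool_set.
have mb : measurable_fun setT (fun w => al_candidate X lam (y w) SN j 0 != 0).
  by apply: measurable_neg; exact: measurable_fun_eqr.
case: (beta j 0 != 0); first by under eq_fun do rewrite eqb_id.
by under eq_fun do rewrite eqbF_neg; exact: measurable_neg.
Qed.

End Measurability.

(** * Coercive quadratic forms *)

Lemma continuous_sum (R : realType) (V : topologicalType) (I : Type) (r : seq I) (f : I -> V -> R) :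
  (forall i, continuous (f i)) -> continuous (fun u => \sum_(i <- r) f i u).
Proof.
move=> cf; elim: r => [|i r IH].
  rewrite (_ : (fun u => _) = cst 0); first exact: cst_continuous.
  by apply/funext => u; rewrite big_nil.
rewrite (_ : (fun u => _) = (fun u => f i u + \sum_(j <- r) f j u)).
  by move=> u; apply: cvgD; [exact: cf|exact: IH].
by apply/funext => u; rewrite big_cons.
Qed.

Lemma continuous_mul (R : realType) (V : topologicalType) (f g : V -> R) :
  continuous f -> continuous g -> continuous (fun u => f u * g u).
Proof. by move=> cf cg u; apply: cvgM; [exact: cf|exact: cg]. Qed.

Section QuadraticForms.
Context (R : realType) (p : nat).
Implicit Types (C : 'M[R]_p) (v : 'cV[R]_p).

Lemma quad_formE C v :
  (v^T *m C *m v) 0 0 = \sum_i \sum_j C i j * (v i 0 * v j 0).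
Proof.
rewrite -mulmxA [LHS]mxE; apply: eq_bigr => i _.
rewrite [X in X * _]mxE [X in _ * X]mxE mulr_sumr; apply: eq_bigr => j _.
ring.
Qed.

(** [k0] witnesses that [p] is positive. *)
Lemma arg_max_coord v (k0 : 'I_p) : exists k, forall j, `|v j 0| <= `|v k 0|.
Proof.
have [k _ H] := @Order.TotalTheory.arg_maxP _ _ _ k0 xpredT (fun k => `|v k 0|) isT.
by exists k => j; exact: H.
Qed.

Lemma sqr_norm_coord (x : R) : x ^+ 2 = `|x| * `|x|.
Proof. by rewrite -normrM ger0_norm ?sqr_ge0// expr2. Qed.

(** If [m] is the largest absolute coordinate, then [a * m ^+ 2 <= h * (p * m)], and [m] cancels.
    Both estimation error bounds come from this. *)
Lemma coord_bound_of_quadratic v (a h : R) : 0 < a -> 0 <= h ->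
    (forall k, a * v k 0 ^+ 2 <= h * \sum_j `|v j 0|) ->
  forall k, `|v k 0| <= p%:R * h / a.
Proof.
move=> a0 h0 H k.
have [k1 k1max] := arg_max_coord v k.
apply: (le_trans (k1max k)); rewrite ler_pdivlMr//.
have [->|m0] := eqVneq `|v k1 0| 0; first by rewrite mul0r mulr_ge0.
have {}m0 : 0 < `|v k1 0| by rewrite lt_def m0 normr_ge0.
rewrite -(ler_pM2l m0).
have sum_le : \sum_j `|v j 0| <= p%:R * `|v k1 0|.
  by rewrite mulr_natl -[X in _ *+ X]card_ord -sumr_const; exact: ler_sum.
have := H k1; have := ler_wpM2l h0 sum_le; rewrite sqr_norm_coord; nra.
Qed.

(** The face [v k 0 = 1] of the cube is compact and avoids 0, so the form attains a positive minimum
    on it. *)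
Lemma pos_def_face_bound C (k : 'I_p) :
    (forall v, v != 0 -> 0 < (v^T *m C *m v) 0 0) ->
  exists2 m : R, 0 < m & forall v, (forall j, `|v j 0| <= 1) -> v k 0 = 1 ->
    m <= (v^T *m C *m v) 0 0.
Proof.
move=> Cpos.
pose F (i : 'I_p) : set R := if i == k then [set 1] else `[-1, 1]%classic.
pose A : set 'rV[R]_p := [set u | forall i, F i (u ord0 i)].
have cA : compact A.
  apply: rV_compact => i; rewrite /F; case: ifP => _; first exact: compact_set1.
  exact: segment_compact.
pose f (u : 'rV[R]_p) := \sum_i \sum_j C i j * (u ord0 i * u ord0 j).
have cf : {within A, continuous f}.
  apply: continuous_subspaceT.
  apply: continuous_sum => i; apply: continuous_sum => j.
  apply: continuous_mul; first exact: cst_continuous.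
  by apply: continuous_mul; exact: coord_continuous.
have A0 : A !=set0.
  exists (const_mx 1) => i; rewrite mxE /F; case: ifP => _ //=.
  by rewrite in_itv/=; apply/andP; split; lra.
have [c cA' cmin] := EVT_min_rV A0 cA cf.
have fE v : f v^T = (v^T *m C *m v) 0 0.
  by rewrite quad_formE; apply: eq_bigr => i _; apply: eq_bigr => j _; rewrite !mxE.
exists (f c).
  rewrite -[c]trmxK fE; apply: (Cpos c^T); apply/eqP => c0.
  have := set_mem cA' k; rewrite /F eqxx -[c]trmxK c0 !mxE => /esym/eqP.
  by rewrite oner_eq0.
move=> v v1 vk; rewrite -fE; apply: cmin; apply/mem_set => i.
rewrite mxE /F; case: eqP => [->//|_] /=.
by rewrite in_itv /= -ler_norml.
Qed.

Lemma pos_def_coercive C :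
    (forall v, v != 0 -> 0 < (v^T *m C *m v) 0 0) ->
  exists2 c : R, 0 < c & forall v k, c * v k 0 ^+ 2 <= (v^T *m C *m v) 0 0.
Proof.
move=> Cpos.
have /choice [m mP] : forall k, exists m : R, 0 < m /\
    forall v, (forall j, `|v j 0| <= 1) -> v k 0 = 1 -> m <= (v^T *m C *m v) 0 0.
  by move=> k; have [m m0 H] := pos_def_face_bound C k Cpos; exists m.
(* The default 1 keeps [c] positive when [p] is 0. *)
pose c := \big[Num.min/1]_k m k.
have c0 : 0 < c.
  by rewrite /c; elim/big_ind: _ => // [x y x0 y0|j _]; [rewrite lt_min x0 y0|have [] := mP j].
exists c => // v k; have [k1 k1max] := arg_max_coord v k.
have cm : c <= m k1 by exact: bigmin_le_cond.
have [v0|vk0] := eqVneq (v k1 0) 0.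
  have z j : v j 0 = 0 by apply/eqP; rewrite -normr_le0 (le_trans (k1max j))// v0 normr0.
  rewrite quad_formE big1 => [|i _]; first by rewrite z expr0n mulr0.
  by rewrite big1// => j _; rewrite !z !mulr0.
have n0 : 0 < `|v k1 0| by rewrite normr_gt0.
(* Dividing by the signed largest coordinate lands on the face where it equals 1, so negative
   coordinates are covered too. *)
have le1 j : `|((v k1 0)^-1 *: v) j 0| <= 1.
  by rewrite mxE normrM normfV mulrC ler_pdivrMr// mul1r.
have := (mP k1).2 _ le1; rewrite mxE mulVf// => /(_ erefl).
set q := (v^T *m C *m v) 0 0.
have -> : (((v k1 0)^-1 *: v)^T *m C *m ((v k1 0)^-1 *: v)) 0 0 = (v k1 0)^-1 ^+ 2 * q.
  rewrite /q !quad_formE mulr_sumr; apply: eq_bigr => i _.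
  by rewrite mulr_sumr; apply: eq_bigr => j _; rewrite !mxE; ring.
have sq0 : 0 < v k1 0 ^+ 2 by rewrite exprn_even_gt0.
move=> mq.
have sqr_le : v k 0 ^+ 2 <= v k1 0 ^+ 2.
  by rewrite !sqr_norm_coord ler_pM// normr_ge0.
have : m k1 * v k1 0 ^+ 2 <= q.
  by move: mq; rewrite exprVn mulrC ler_pdivlMr.
have := ler_wpM2l (ltW c0) sqr_le; have := ler_wpM2r (ltW sq0) cm; lra.
Qed.

(** An entrywise error [delta] moves the form by at most [p ^ 2 * delta] times the largest squared
    coordinate, so coercivity is applied at that coordinate. *)
Lemma coercive_perturb C (Q : 'M[R]_p) (c delta : R) :
    (forall v k, c * v k 0 ^+ 2 <= (v^T *m C *m v) 0 0) ->
    (forall i j, `|Q i j - C i j| <= delta) -> p%:R ^+ 2 * delta <= c ->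
  forall v k, (c - p%:R ^+ 2 * delta) * v k 0 ^+ 2 <= (v^T *m Q *m v) 0 0.
Proof.
move=> Ccoer QC dc v k; have [k1 k1max] := arg_max_coord v k.
have sqr_le : v k 0 ^+ 2 <= v k1 0 ^+ 2.
  by rewrite !sqr_norm_coord ler_pM// normr_ge0.
rewrite (@le_trans _ _ ((c - p%:R ^+ 2 * delta) * v k1 0 ^+ 2))//.
  by rewrite ler_wpM2l// subr_ge0.
have diffE : (v^T *m Q *m v) 0 0 =
    (v^T *m C *m v) 0 0 + \sum_i \sum_j (Q i j - C i j) * (v i 0 * v j 0).
  rewrite !quad_formE -big_split; apply: eq_bigr => i _ /=.
  by rewrite -big_split; apply: eq_bigr => j _ /=; ring.
have err : `|\sum_i \sum_j (Q i j - C i j) * (v i 0 * v j 0)| <= p%:R ^+ 2 * delta * v k1 0 ^+ 2.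
  have -> : p%:R ^+ 2 * delta * v k1 0 ^+ 2 = \sum_(i < p) \sum_(j < p) delta * v k1 0 ^+ 2.
    rewrite !sumr_const !card_ord -[RHS]mulr_natl -[X in _ = _ * X]mulr_natl; ring.
  apply: (le_trans (ler_norm_sum _ _ _)); apply: ler_sum => i _.
  apply: (le_trans (ler_norm_sum _ _ _)); apply: ler_sum => j _.
  rewrite !normrM sqr_norm_coord ler_pM// ?mulr_ge0//.
  by rewrite ler_pM.
have := Ccoer v k1; move: err; rewrite ler_norml => /andP[err _].
rewrite diffE; lra.
Qed.
End QuadraticForms.

(** * Support of a minimizer on the good event *)

Section Selection.
Context {R : realType} {n p : nat}.
Variables (X : 'M[R]_(n, p)) (lam : 'I_p -> R) (beta : 'cV[R]_p) (e : 'cV[R]_n).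
(** The setting is deterministic: [r] stands for the square root of [n], [M * r] bounds the noise
    score, [L] bounds the tuning parameters, and [b0] bounds the nonzero signals from below. *)
Variables (c K M L r b0 : R).
Let y := X *m beta + e.
Let g := X^T *m e.
Let Q := X^T *m X.
Hypothesis c0 : 0 < c.
Hypothesis K0 : 0 <= K.
Hypothesis M0 : 0 < M.
Hypothesis r0 : 0 < r.
Hypothesis b00 : 0 < b0.
Hypothesis coercive : forall (v : 'cV[R]_p) k, c * r ^+ 2 * v k 0 ^+ 2 <= \sum_i (X *m v) i 0 ^+ 2.
Hypothesis gram_le : forall i j, `|Q i j| <= K * r ^+ 2.
Hypothesis noise_le : forall k, `|g k 0| <= M * r.
Hypothesis lam0 : forall j, 0 <= lam j.
Hypothesis lamL : forall j, lam j <= L.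
Hypothesis beta_ge : forall j, beta j 0 != 0 -> b0 <= `|beta j 0|.
Hypothesis lsq_neq0 : forall j, lsq X y j 0 != 0.
(** [noise_small] keeps active least squares coordinates at least [b0 / 2] in size, [bias_small]
    makes the estimation error less than [b0], and [lam_large] excludes false selections. *)
Hypothesis noise_small : p%:R * M <= b0 / 2 * (c * r).
Hypothesis bias_small : p%:R * (2 * M * r + 4 * L / b0) < b0 * (c * r ^+ 2).
Hypothesis lam_large : forall j,
  (M * r + p%:R * K * (p%:R * (2 * M * r + 4 * L / b0)) / c) * (p%:R * M) < lam j * (c * r).

Let cr0 : 0 < c * r ^+ 2. Proof. by rewrite mulr_gt0// exprn_gt0. Qed.

Let rX : Q \in unitmx.
Proof.
apply: unitmx_ker0 => v Qv0; apply/colP => k; rewrite [RHS]mxE.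
have := coercive v k; rewrite sum_sqr_mulmx big1 => [|j _]; last first.
  by rewrite -/Q Qv0 mxE mulr0.
rewrite pmulr_rle0// => vk; apply/eqP; rewrite -sqrf_eq0.
by rewrite eq_le vk sqr_ge0.
Qed.

Let lsqE j : lsq X y j 0 = beta j 0 + (invmx Q *m g) j 0.
Proof.
by rewrite /lsq /y -/Q -mulmxA mulmxDr mulmxA -/Q mulmxDr mulKmx// mxE.
Qed.

Let sum_noise_le (v : 'cV[R]_p) : \sum_j g j 0 * v j 0 <= M * r * \sum_j `|v j 0|.
Proof.
rewrite mulr_sumr; apply: ler_sum => j _.
by rewrite (le_trans (ler_norm _))// normrM ler_wpM2r.
Qed.

(** The error [u] solves [Q *m u = g], so its quadratic form is the inner product of [g] and [u], at
    most [M * r] times the sum of the [|u j 0|]. *)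
Let lsq_error k : `|(invmx Q *m g) k 0| <= p%:R * M / (c * r).
Proof.
set u := invmx Q *m g.
have -> : p%:R * M / (c * r) = p%:R * (M * r) / (c * r ^+ 2).
  by field; rewrite !gt_eqF.
apply: coord_bound_of_quadratic => //; first by rewrite mulr_ge0// ltW.
move=> j; apply: (le_trans (coercive u j)).
rewrite sum_sqr_mulmx -/Q /u mulKVmx// -/u.
by under eq_bigr do rewrite mulrC; exact: sum_noise_le.
Qed.

(** The bounds on [lam] reach [L] only through an index, hence the argument [j]. *)
Let L0 (j : 'I_p) : 0 <= L. Proof. exact: le_trans (lam0 j) (lamL j). Qed.

(** Inactive coordinates of [beta] cannot lower their penalty. On active ones the least squares
    value is at least [b0 / 2], so the weight is at most [2 * L / b0]. *)
Let penalty_slack (v : 'cV[R]_p) j :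
  al_weight X lam y j * (`|beta j 0| - `|beta j 0 + v j 0|) <= 2 * L / b0 * `|v j 0|.
Proof.
have w0 : 0 <= al_weight X lam y j by rewrite divr_ge0.
have Lb0 : 0 <= 2 * L / b0.
  by apply: divr_ge0; [apply: mulr_ge0 => //; exact: L0 j|exact: ltW].
have [->|bj] := eqVneq (beta j 0) 0.
  rewrite normr0 !add0r mulrN.
  have : 0 <= 2 * L / b0 * `|v j 0| by rewrite mulr_ge0.
  have : 0 <= al_weight X lam y j * `|v j 0| by rewrite mulr_ge0.
  lra.
have wle : al_weight X lam y j <= 2 * L / b0.
  have lsqj : b0 / 2 <= `|lsq X y j 0|.
    rewrite lsqE; have := lsq_error j.
    have : p%:R * M / (c * r) <= b0 / 2 by rewrite ler_pdivrMr// mulr_gt0.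
    have := beta_ge j bj.
    have := ler_normB (beta j 0 + (invmx Q *m g) j 0) ((invmx Q *m g) j 0).
    rewrite addrK; lra.
  rewrite /al_weight ler_pdivrMr ?normr_gt0//.
  apply: (le_trans (lamL j)).
  have LE : 2 * L / b0 * (b0 / 2) = L by field; rewrite gt_eqF.
  by rewrite -[X in X <= _]LE ler_wpM2l.
have tri : `|beta j 0| - `|beta j 0 + v j 0| <= `|v j 0|.
  have := ler_normB (beta j 0 + v j 0) (v j 0); rewrite addrK; lra.
by rewrite (le_trans (ler_wpM2l w0 tri))// ler_wpM2r.
Qed.

(** Expanding the objective at [beta], where the score is [g], bounds the quadratic term by twice
    the noise term plus twice the penalty slack; these give [2 * M * r] and [4 * L / b0]. *)
Lemma al_error_bound b : is_al X lam y b ->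
  forall k, `|(b - beta) k 0| <= p%:R * (2 * M * r + 4 * L / b0) / (c * r ^+ 2).
Proof.
move=> opt k; set v := b - beta.
apply: coord_bound_of_quadratic => //.
  have := mulr_gt0 M0 r0; have := divr_ge0 (L0 k) (ltW b00); lra.
move=> j; apply: (le_trans (coercive v j)).
have := opt beta; rewrite -{1}[b](subrK beta) -/v [v + beta]addrC al_objD.
have -> : score X y beta = g by rewrite /score /y addrC addKr.
have := sum_noise_le v.
have : \sum_j al_weight X lam y j * (`|beta j 0| - `|beta j 0 + v j 0|)
    <= 2 * L / b0 * \sum_j `|v j 0|.
  by rewrite mulr_sumr; apply: ler_sum => i _; exact: penalty_slack.
have -> : \sum_j al_weight X lam y j * (`|beta j 0 + v j 0| - `|beta j 0|) =
    - \sum_j al_weight X lam y j * (`|beta j 0| - `|beta j 0 + v j 0|).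
  by rewrite -sumrN; apply: eq_bigr => i _; ring.
set S := \sum_j `|v j 0|.
set A := \sum_i _ ^+ 2; set B := \sum_j g j 0 * _; set D := \sum_j al_weight _ _ _ _ * _.
set E := al_obj _ _ _ _.
lra.
Qed.

Lemma selection_consistent b : is_al X lam y b ->
  forall j, (b j 0 != 0) <-> (beta j 0 != 0).
Proof.
move=> opt j; have err := al_error_bound b opt; split=> bj; last first.
  apply/negP => /eqP bj0; have := err j; rewrite mxE bj0 add0r mxE normrN.
  have := beta_ge j bj.
  have : p%:R * (2 * M * r + 4 * L / b0) / (c * r ^+ 2) < b0.
    by rewrite ltr_pdivrMr.
  lra.
apply/negP => /eqP betaj0.
have [_ sj] := (is_alP X lam y b lam0).1 opt j.
have w0 : 0 <= al_weight X lam y j by rewrite divr_ge0.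
(* Since [b j 0] is nonzero, complementarity turns the bound on the score into an equality. *)
have scoreE : `|score X y b j 0| = al_weight X lam y j.
  have nb : `|b j 0| != 0 by rewrite normr_eq0.
  by apply: (mulIf nb); rewrite -normrM sj normrM ger0_norm// normr_id.
set v := b - beta in err.
have gE : score X y b = g - Q *m v.
  by rewrite /score /y /v /g mulmxBr mulmxDr mulmxBr !mulmxA opprB addrA addrAC addrC -addrA.
have lamj := lam_large j.
set H := p%:R * (2 * M * r + 4 * L / b0) in err lamj *.
(* Each of the [p] terms of [Q *m v] is at most [K * r ^+ 2] times [H / (c * r ^+ 2)], where [r]
   cancels. *)
have score_le : `|score X y b j 0| <= M * r + p%:R * K * H / c.
  rewrite gE mxE [X in _ + X]mxE (le_trans (ler_normB _ _))// lerD//.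
  rewrite mxE (le_trans (ler_norm_sum _ _ _))//.
  have -> : p%:R * K * H / c = \sum_(k < p) (K * r ^+ 2) * (H / (c * r ^+ 2)).
    rewrite sumr_const card_ord -[RHS]mulr_natl; field.
    by rewrite !gt_eqF// exprn_gt0.
  by apply: ler_sum => k _; rewrite normrM ler_pM.
have uj : lsq X y j 0 = (invmx Q *m g) j 0 by rewrite lsqE betaj0 add0r.
have u0 : 0 < `|lsq X y j 0| by rewrite normr_gt0.
have weq : al_weight X lam y j * `|lsq X y j 0| = lam j.
  by rewrite /al_weight divfK// gt_eqF.
have ule : `|lsq X y j 0| * (c * r) <= p%:R * M.
  by rewrite -ler_pdivlMr ?mulr_gt0// uj; exact: lsq_error.
move: score_le; rewrite scoreE => score_le.
(* Multiplying the weight by the least squares value recovers [lam j]; the resulting bound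
   contradicts [lam_large]. *)
have : lam j * (c * r) <= (M * r + p%:R * K * H / c) * (p%:R * M).
  by rewrite -weq -mulrA ler_pM// mulr_ge0 ?ltW// mulr_gt0.
lra.
Qed.

End Selection.

(** * Asymptotics *)

Section SelectionProbability.
Context d (T : measurableType d) (R : realType) (P : probability T R).

Lemma union_bound (I : Type) (r : seq I) (A : I -> set T) (t : R) :
    (forall i, measurable (A i)) -> (forall i, (P (A i) <= t%:E)%E) ->
  (P (\big[setU/set0]_(i <- r) A i) <= ((size r)%:R * t)%:E)%E.
Proof.
move=> mA At; elim: r => [|i r IH]; first by rewrite big_nil measure0 mul0r.
rewrite big_cons -natr1 mulrDl mul1r addrC EFinD.
apply: le_trans (leeD (At i) IH); apply: measureU2 => //.
exact: bigsetU_measurable.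
Qed.

Context (n p : nat) (X : 'M[R]_(n, p)) (lam : 'I_p -> R) (beta : 'cV[R]_p).
Context (e : 'I_n -> {RV P >-> R}) (s c K M r b0 : R).

(** Each noise score has variance [s] times a diagonal Gram entry, at most [s * K * r ^+ 2].
    Chebyshev at level [M * r] cancels [r], and a union bound over [p] coordinates gives the failure
    probability. *)
Lemma sel_consistent_event_probability :
    \rank X = p -> mutually_independent e ->
    (forall i, (e i : T -> R) \in Lfun P 2%:E) ->
    (forall i, ('E_P[e i] = 0)%E) -> (forall i, variance P (e i) = s%:E) -> 0 <= s ->
    (forall j, P [set w | lsq X (resp X beta e w) j 0 = 0] = 0%E) ->
    (forall j, 0 <= lam j) ->
    0 < c -> 0 <= K -> 0 < M -> 0 < r -> 0 < b0 ->
    (forall (v : 'cV[R]_p) k, c * r ^+ 2 * v k 0 ^+ 2 <= \sum_i (X *m v) i 0 ^+ 2) ->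
    (forall i j, `|(X^T *m X) i j| <= K * r ^+ 2) ->
    (forall j, beta j 0 != 0 -> b0 <= `|beta j 0|) ->
    p%:R * M <= b0 / 2 * (c * r) ->
    p%:R * (2 * M * r + 4 * lam_star lam / b0) < b0 * (c * r ^+ 2) ->
    (forall j, (M * r + p%:R * K * (p%:R * (2 * M * r + 4 * lam_star lam / b0)) / c) *
      (p%:R * M) < lam j * (c * r)) ->
  ((1 - p%:R * (s * K / M ^+ 2))%:E <= P (sel_consistent_event X lam beta e))%E.
Proof.
move=> rX inde e2 e0 ves s0 lsq0 lam0 c0 K0 M0 r0 b00 coer gram_le beta_ge h1 h2 h3.
pose A j := [set w | lsq X (resp X beta e w) j 0 == 0].
pose B j := [set w | M * r <= `|\sum_i X i j * e i w|].
have mA j : measurable (A j).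
  apply: measurable_bool_set; apply: measurable_fun_eqr => //; exact: measurable_lsq.
have mB j : measurable (B j).
  apply: measurable_bool_set; apply: measurable_fun_ler => //.
  apply: (@measurableT_comp _ _ _ _ _ _ (@Num.norm R R)) => //.
  apply: measurable_sum => i; apply: measurable_funM => //; exact: measurable_funP.
have PA j : P (A j) = 0%E.
  rewrite -[RHS](lsq0 j); congr (P _).
  by apply/seteqP; split=> w /= /eqP.
have PB j : (P (B j) <= (s * K / M ^+ 2)%:E)%E.
  apply: (le_trans (chebyshev_linear_combination _ _ _ _ _ _ _ _ _ inde e2 e0 ves _)).
    exact: mulr_gt0.
  rewrite lee_fin -!mulrA ler_wpM2l// exprMn invfM mulrA ler_pdivrMr ?exprn_gt0//.
  have -> : K * M ^- 2 * r ^+ 2 = K * r ^+ 2 * M ^- 2 by ring.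
  rewrite ler_wpM2r ?invr_ge0 ?sqr_ge0//.
  apply: le_trans (gram_le j j); apply: le_trans (ler_norm _).
  by rewrite mxE; apply: ler_sum => i _; rewrite mxE expr2.
pose bad := \big[setU/set0]_(j < p) (A j `|` B j).
have mbad : measurable bad.
  by apply: bigsetU_measurable => j _; exact: measurableU.
have Pbad : (P bad <= (p%:R * (s * K / M ^+ 2))%:E)%E.
  have := union_bound _ (index_enum 'I_p) (fun j => A j `|` B j) (s * K / M ^+ 2).
  rewrite [size _](_ : _ = p); last by rewrite -[RHS]card_ord cardT enumT.
  apply=> j; first exact: measurableU.
  rewrite setUC measureU0; [exact: PB|exact: mB|exact: mA|exact: PA].
apply: (@le_trans _ _ (P (~` bad))).
  by rewrite probability_setC// EFinB leeB.
apply: le_measure; rewrite ?inE.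
- exact: measurableC.
- exact: measurable_sel_consistent_event.
move=> w /= nbad.
have nA j : lsq X (resp X beta e w) j 0 != 0.
  by apply/negP => Aj; apply: nbad; rewrite /bad (bigD1 j)//=; left; left.
split=> // b opt.
apply: (selection_consistent X lam beta (\col_i e i w) c K M (lam_star lam) r b0) => //.
  move=> k; rewrite leNgt; apply/negP => Bk; apply: nbad; rewrite /bad (bigD1 k)//=.
  left; right; apply: ltW; move: Bk; rewrite mxE /B /=.
  by under eq_bigr do rewrite !mxE.
by move=> j; exact: le_bigmax.
Qed.
End SelectionProbability.

(** * Bounds valid for all large [n] *)

Section Asymptotics.
Context {R : realType}.

Lemma sqrt_nat_ge (A : R) : \forall n \near \oo, A <= Num.sqrt n%:R.
Proof.
near=> n; apply: (le_trans (ler_norm A)); rewrite -sqrtr_sqr ler_wsqrtr//.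
by near: n; exact: nbhs_infty_ger.
Unshelve. all: by end_near. Qed.

Lemma lam_star_ge0 (p : nat) (lam : 'I_p -> R) : (forall j, 0 <= lam j) -> 0 <= lam_star lam.
Proof. by move=> lam0; rewrite /lam_star; elim/big_ind: _ => // x y x0 y0; rewrite le_max x0. Qed.

Lemma eventually_lam_star_le (p : nat) (lam : nat -> 'I_p -> R) (delta : R) :
    0 < delta -> (fun n : nat => lam_star (lam n) / n%:R) @ \oo --> 0 ->
  \forall n \near \oo, lam_star (lam n) <= delta * n%:R.
Proof.
move=> d0 /cvgrPdist_le /(_ _ d0) H; near=> n.
have n0 : 0 < n%:R :> R by rewrite ltr0n; near: n; exact: nbhs_infty_gt.
rewrite -ler_pdivrMr//; apply: (le_trans (ler_norm _)).
by rewrite -normrN -[X in `|X|]add0r; near: n.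
Unshelve. all: by end_near. Qed.

(** Divergence of [lam] absorbs twice the [a] term, divergence of the ratio absorbs twice the [g]
    term, and the two bounds are averaged. *)
Lemma eventually_lam_dominates (p : nat) (lam : nat -> 'I_p -> R) (a g c : R) :
    0 <= a -> 0 <= g -> 0 < c -> (forall n j, 0 <= lam n j) ->
    (forall j, (fun n : nat => lam n j) @ \oo --> +oo) ->
    (forall j, (fun n : nat => Num.sqrt n%:R * lam n j / lam_star (lam n)) @ \oo --> +oo) ->
  \forall n \near \oo, forall j,
    a * Num.sqrt n%:R + g * lam_star (lam n) < lam n j * (c * Num.sqrt n%:R).
Proof.
move=> a0 g0 c0 lam0 lamy ratioy; apply: filter_forall => j.
have /cvgryPge H1 := lamy j; have /cvgryPge H2 := ratioy j.
near=> n.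
have r0 : 0 < Num.sqrt n%:R :> R.
  by rewrite sqrtr_gt0 ltr0n; near: n; exact: nbhs_infty_gt.
have h1 : (2 * a + 1) / c <= lam n j by near: n; exact: H1.
have h2 : 2 * g / c + 1 <= Num.sqrt n%:R * lam n j / lam_star (lam n) by near: n; exact: H2.
set r := Num.sqrt _ in r0 h2 *; set L := lam_star _ in h2 *.
have gc : 0 <= 2 * g / c by rewrite divr_ge0 ?mulr_ge0// ltW.
(* If [L] were 0, the ratio would be 0 by the division convention, against its lower bound. *)
have L0 : 0 < L.
  rewrite lt_def lam_star_ge0// andbT; apply/eqP => L0; move: h2.
  by rewrite L0 invr0 mulr0; lra.
move: h2; rewrite ler_pdivlMr// => h2.
move: h1; rewrite ler_pdivrMr// => h1.
have : (2 * g / c + 1) * L * c <= r * lam n j * c by rewrite ler_pM2r.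
have -> : (2 * g / c + 1) * L * c = 2 * g * L + L * c by field; rewrite gt_eqF.
have : 0 < L * c by exact: mulr_gt0.
have : (2 * a + 1) * r <= lam n j * c * r by rewrite ler_pM2r.
lra.
Unshelve. all: by end_near. Qed.

End Asymptotics.

Lemma beta_min_signal (R : realType) (p : nat) (beta : 'cV[R]_p) :
  exists2 b0 : R, 0 < b0 & forall j, beta j 0 != 0 -> b0 <= `|beta j 0|.
Proof.
(* The default 1 covers [beta = 0]. *)
exists (\big[Num.min/1]_(j | beta j 0 != 0) `|beta j 0|).
  elim/big_ind: _ => // [x y x0 y0|j bj]; first by rewrite lt_min x0.
  by rewrite normr_gt0.
by move=> j bj; exact: bigmin_le_cond.
Qed.

Lemma eventually_gram_bounds (R : realType) (p : nat) (X : forall n : nat, 'M[R]_(n, p))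
    (C : 'M[R]_p) :
    (forall i j, (fun n : nat => ((X n)^T *m X n) i j / n%:R) @ \oo --> C i j) ->
    (forall v : 'cV[R]_p, v != 0 -> 0 < (v^T *m C *m v) 0 0) ->
  exists c K : R, [/\ 0 < c, 0 <= K & \forall n \near \oo,
    (forall (v : 'cV[R]_p) k, c * n%:R * v k 0 ^+ 2 <= \sum_i (X n *m v) i 0 ^+ 2) /\
    (forall i j, `|((X n)^T *m X n) i j| <= K * n%:R)].
Proof.
move=> XC Cpos; have [c c0 Ccoer] := pos_def_coercive R p C Cpos.
pose p2 : R := p%:R ^+ 2.
have p20 : 0 <= p2 by exact: sqr_ge0.
(* Chosen so that [p2 * delta] is at most [c / 2], which leaves half of the coercivity constant of
   [C]. *)
pose delta := c / (2 * (p2 + 1)).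
have delta0 : 0 < delta by rewrite divr_gt0// mulr_gt0//; lra.
have deltaE : 2 * (p2 * delta) + 2 * delta = c.
  by rewrite /delta; field; rewrite gt_eqF//; lra.
pose S := \sum_i \sum_j `|C i j|.
have CS i j : `|C i j| <= S.
  rewrite /S (bigD1 i)//= (bigD1 j)//= -addrA lerDl.
  by apply: addr_ge0; apply: sumr_ge0 => // k _; exact: sumr_ge0.
exists (c / 2), (S + delta); split.
- by rewrite divr_gt0.
- by apply: addr_ge0; [apply: sumr_ge0 => i _; exact: sumr_ge0|exact: ltW].
have QC : \forall n \near \oo, forall i j,
    `|((X n)^T *m X n) i j / n%:R - C i j| <= delta.
  apply: filter_forall => i; apply: filter_forall => j.
  have /cvgrPdist_le /(_ _ delta0) H := XC i j.
  by near=> n; rewrite distrC; near: n.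
near=> n.
have n0 : 0 < n%:R :> R by rewrite ltr0n; near: n; exact: nbhs_infty_gt.
have QCn : forall i j, `|((X n)^T *m X n) i j / n%:R - C i j| <= delta by near: n.
split=> [v k|i j].
  have QCn' i j : `|(n%:R^-1 *: ((X n)^T *m X n)) i j - C i j| <= delta.
    by rewrite mxE mulrC.
  have := coercive_perturb R p C _ c delta Ccoer QCn' _ v k.
  have -> : (v^T *m (n%:R^-1 *: ((X n)^T *m X n)) *m v) 0 0 =
      (\sum_i (X n *m v) i 0 ^+ 2) / n%:R.
    rewrite sum_sqr_mulmx quad_formE mulr_suml; apply: eq_bigr => i _.
    rewrite mxE mulr_sumr mulr_suml; apply: eq_bigr => j _.
    by rewrite mxE; ring.
  rewrite ler_pdivlMr// -/p2 => /(_ _) H.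
  have {}H := H ltac:(lra).
  apply: le_trans H; rewrite mulrAC ler_pM2r// ler_wpM2r ?sqr_ge0//; lra.
set q := ((X n)^T *m X n) i j.
have -> : q = (q / n%:R) * n%:R by rewrite divfK// gt_eqF.
rewrite normrM [`|n%:R|]gtr0_norm// ler_pM2r//.
have -> : q / n%:R = C i j + (q / n%:R - C i j) by rewrite addrC subrK.
by apply: (le_trans (ler_normD _ _)); exact: lerD (CS i j) (QCn i j).
Unshelve. all: by end_near. Qed.

Theorem theorem2 (d : measure_display) (T : measurableType d) (R : realType)
  (P : probability T R) (p : nat)
  (X : forall n : nat, 'M[R]_(n, p))
  (C : 'M[R]_p)
  (eps : forall n : nat, 'I_n -> {RV P >-> R})
  (sigma : R)
  (lam : nat -> 'I_p -> R) :
  (* design: full column rank, X'X/n -> C positive definite *)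
  (forall n, (p <= n)%N -> \rank (X n) = p) ->
  (forall i j, (fun n : nat => ((X n)^T *m X n) i j / n%:R) @ \oo --> C i j) ->
  (forall v : 'cV[R]_p, v != 0 -> 0 < (v^T *m C *m v) 0 0) ->
  (* errors: i.i.d. components, mean zero, finite variance sigma^2 > 0 *)
  (forall n, mutually_independent (eps n)) ->
  (forall n m (i : 'I_n) (j : 'I_m) (A : set R), measurable A ->
     P (eps n i @^-1` A) = P (eps m j @^-1` A)) ->
  (forall n (i : 'I_n), (eps n i : T -> R) \in Lfun P 2%:E) ->
  (forall n (i : 'I_n), ('E_P[eps n i] = 0)%E) ->
  0 < sigma ->
  (forall n (i : 'I_n), variance P (eps n i) = (sigma ^+ 2)%:E) ->
  (* the events {bLS_j = 0} have probability zero *)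
  (forall (beta : 'cV[R]_p) n (j : 'I_p), (p <= n)%N ->
     P [set w | lsq (X n) (resp (X n) beta (eps n) w) j 0 = 0] = 0%E) ->
  (* tuning parameters *)
  (forall n j, 0 <= lam n j) ->
  (fun n : nat => lam_star (lam n) / n%:R) @ \oo --> 0 ->
  (forall j, (fun n : nat => lam n j) @ \oo --> +oo) ->
  (forall j, (fun n : nat => Num.sqrt n%:R * lam n j / lam_star (lam n)) @ \oo --> +oo) ->
  forall beta : 'cV[R]_p,
    (fun n : nat => P (sel_consistent_event (X n) (lam n) beta (eps n))) @ \oo --> 1%E.
Proof.
move=> rX XC Cpos inde iid e2 e0 sigma0 ves lsq0 lam0 lamn lamy ratioy beta.
have [c [K [c0 K0 gram]]] := eventually_gram_bounds R p X C XC Cpos.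
have [b0 b00 beta_ge] := beta_min_signal R p beta.
apply/fine_cvgP; split.
  near=> n; apply: fin_num_measure; apply: measurable_sel_consistent_event => //.
  by apply: rX; near: n; exact: nbhs_infty_ge.
apply/cvgrPdist_le => eta eta0.
pose q := p%:R * (sigma ^+ 2 * K).
have q0 : 0 <= q by apply: mulr_ge0 => //; apply: mulr_ge0 => //; exact: sqr_ge0.
(* [M] is fixed before [n], making the failure probability at most [eta]; with [x = q / eta], the
   witness works because [x <= (1 + x) ^+ 2]. *)
have [M M0 qM] : exists2 M : R, 0 < M & q / M ^+ 2 <= eta.
  have qeta : 0 <= q / eta by rewrite divr_ge0// ltW.
  exists (1 + q / eta); first lra.
  rewrite ler_pdivrMr; last by rewrite exprn_gt0//; lra.
  by rewrite mulrC -ler_pdivrMr//; nra.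
have [c0' M0' b00'] : [/\ 0 <= c, 0 <= M & 0 <= b0] by split; exact: ltW.
pose B := 2 * M * p%:R.
have p0 : 0 <= p%:R :> R by [].
have B0 : 0 <= B by rewrite !mulr_ge0// ltW.
(* With this [delta] the penalty part of the error takes at most half of the budget [b0 * c * n];
   the noise part takes less than the other half. *)
pose delta := b0 ^+ 2 * c / (8 * (p%:R + 1)).
have p1 : 0 < p%:R + 1 :> R by lra.
have delta0 : 0 < delta by rewrite divr_gt0// mulr_gt0// exprn_gt0.
near=> n.
have n0 : 0 < n%:R :> R by rewrite ltr0n; near: n; exact: nbhs_infty_gt.
have r0 : 0 < Num.sqrt n%:R :> R by rewrite sqrtr_gt0.
have r2 : Num.sqrt n%:R ^+ 2 = n%:R :> R by rewrite sqr_sqrtr// ltW.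
have pn : (p <= n)%N by near: n; exact: nbhs_infty_ge.
have [coer gram_le] : (forall (v : 'cV[R]_p) k,
      c * n%:R * v k 0 ^+ 2 <= \sum_i (X n *m v) i 0 ^+ 2) /\
    (forall i j, `|((X n)^T *m X n) i j| <= K * n%:R) by near: n.
(* This threshold serves both the least squares condition, [B <= b0 * c * r], and the noise half of
   the error budget. *)
have rB : (2 * B + 1) / (b0 * c) <= Num.sqrt n%:R by near: n; exact: sqrt_nat_ge.
have Ln : lam_star (lam n) <= delta * n%:R by near: n; exact: eventually_lam_star_le.
(* The requirement on [lam] is regrouped as a linear combination of [Num.sqrt n%:R] and
   [lam_star]. *)
have lam_large : forall j,
  ((M + p%:R * K * (p%:R * (2 * M)) / c) * (p%:R * M)) * Num.sqrt n%:R +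
  (p%:R * K * (p%:R * (4 / b0)) / c * (p%:R * M)) * lam_star (lam n) <
    lam n j * (c * Num.sqrt n%:R).
  near: n; apply: eventually_lam_dominates => //.
    by rewrite !(mulr_ge0, addr_ge0, invr_ge0).
  by rewrite !(mulr_ge0, invr_ge0).
have bc0 : 0 < b0 * c by exact: mulr_gt0.
move: rB; rewrite ler_pdivrMr// => rB.
have rX' := rX n pn.
have := sel_consistent_event_probability _ _ _ P n p (X n) (lam n) beta (eps n)
  (sigma ^+ 2) c K M (Num.sqrt n%:R) b0 rX' (inde n) (e2 n) (e0 n) (ves n) (sqr_ge0 _)
  (fun j => lsq0 beta n j pn) (lam0 n) c0 K0 M0 r0 b00.
rewrite r2 => /(_ coer gram_le beta_ge).
set r := Num.sqrt n%:R in r0 r2 rB lam_large *; set L := lam_star (lam n) in Ln lam_large *.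
have L0 : 0 <= L by exact: lam_star_ge0.
move=> PE.
have {}PE : ((1 - p%:R * (sigma ^+ 2 * K / M ^+ 2))%:E <=
    P (sel_consistent_event (X n) (lam n) beta (eps n)))%E.
  apply: PE => [||j].
  - have : B <= b0 * c * r by nra.
    rewrite /B; lra.
  - have h1 : p%:R * (2 * M * r) < b0 * c * n%:R / 2.
      have : (2 * B + 1) * r <= r * (b0 * c) * r by rewrite ler_pM2r.
      rewrite -r2 /B; nra.
    have h2 : p%:R * (4 * L / b0) <= b0 * c * n%:R / 2.
      have -> : p%:R * (4 * L / b0) = 4 * p%:R / b0 * L by ring.
      apply: (@le_trans _ _ (4 * p%:R / b0 * (delta * n%:R))).
        by rewrite ler_wpM2l// divr_ge0 ?mulr_ge0// ltW.
      have -> : 4 * p%:R / b0 * (delta * n%:R) = b0 * c * n%:R / 2 * (p%:R / (p%:R + 1)).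
        by rewrite /delta; field; rewrite !gt_eqF.
      rewrite ger_pMr ?divr_gt0 ?mulr_gt0// ler_pdivrMr//; lra.
    rewrite mulrDr; lra.
  - apply: le_lt_trans (lam_large j); rewrite le_eqVlt; apply/orP; left; apply/eqP.
    by field; rewrite !gt_eqF.
have mE : measurable (sel_consistent_event (X n) (lam n) beta (eps n)).
  exact: measurable_sel_consistent_event.
have PE1 := probability_le1 P mE.
move: PE PE1; rewrite -[P _]fineK ?fin_num_measure// !lee_fin /= => PE PE1.
rewrite ger0_norm ?subr_ge0//.
move: qM; rewrite /q -mulrA; lra.
Unshelve. all: by end_near. Qed.
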